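(* Let $n\ge 0$. Sending a convex topology $T$ on the totally ordered set $\{1<2<\dots<n+1\}$ to the set of points $(n+1-b,\,a-1)\in\mathcal{Q}(n)$ such that $1\le a\le b\le n+1$ and the interval $\{a,a+1,\dots,b\}$ is open in $T$ defines a bijection between the set of convex topologies on an $(n+1)$-point totally ordered set and $\mathcal{P}(n)$. In particular, $P_n=|\mathcal{P}(n)|$ is the number of convex topologies on an $(n+1)$-point totally ordered set.
   Context: A topology on a totally ordered set is called convex if it has a base of (order-)convex sets. For a finite totally ordered set the non-empty convex subsets are exactly the intervals. For an integer $n\ge 0$, let $\mathcal{Q}(n)=\{(x,y)\in\mathbb{Z}^2: 0\le x,\ 0\le y,\ x+y\le n\}$. The map $\{a,\dots,b\}\mapsto(n+1-b,a-1)$ is a bijection from the non-empty intervals of $\{1<\dots<n+1\}$ to $\mathcal{Q}(n)$. Let $\mathcal{R}(n)$ be the set of all subsets $Y\subseteq\mathcal{Q}(n)$ such that: for any $(a,b),(c,d)\in Y$ with $\max(a,c)+\max(b,d)\le n+1$, we have $(\min(a,c),\min(b,d))\in Y$ and, additionally, $(\max(a,c),\max(b,d))\in Y$ as soon as $(\max(a,c),\max(b,d))\in\mathcal{Q}(n)$. Let $\mathcal{P}(n)=\{X\in\mathcal{R}(n): (0,0)\in X\}$. *)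

(* Defs.v *)
From mathcomp Require Import all_boot all_order.

Set Implicit Arguments.
Unset Strict Implicit.
Unset Printing Implicit Defensive.

Section Topologies.
Variable T : finType.
Implicit Types (tau B : {set {set T}}).

Definition is_topology tau : bool :=
  [&& set0 \in tau, setT \in tau,
      [forall F : {set {set T}}, (F \subset tau) ==> (cover F \in tau)]
    & [forall U in tau, forall V in tau, U :&: V \in tau]].

Definition is_base B tau : bool :=
  (B \subset tau) &&
  [forall U in tau, exists F : {set {set T}}, (F \subset B) && (U == cover F)].

End Topologies.

Section ConvexTopologies.
Variables (disp : Order.disp_t) (T : finOrderType disp).

Definition order_convex (A : {set T}) : bool :=
  [forall x in A, forall y in A, forall z, (x <= z <= y)%O ==> (z \in A)].

Definition is_convex_topology (tau : {set {set T}}) : bool :=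
  is_topology tau &&
  [exists B : {set {set T}}, is_base B tau && [forall A in B, order_convex A]].

Definition convex_topologies : {set {set {set T}}} :=
  [set tau | is_convex_topology tau].

End ConvexTopologies.

Arguments convex_topologies {disp} T.

(* Every point of Q(n) has both coordinates in {0, ..., n}, so Q(n) and its   *)
(* subsets are finite sets over this type.                                    *)
Definition point (n : nat) : finType := ('I_n.+1 * 'I_n.+1)%type.

Definition calQ (n : nat) : {set point n} := [set p : point n | p.1 + p.2 <= n].

Definition pmin n (p q : point n) : point n :=
  (Order.min p.1 q.1, Order.min p.2 q.2).

Definition pmax n (p q : point n) : point n :=
  (Order.max p.1 q.1, Order.max p.2 q.2).

Definition calR (n : nat) : {set {set point n}} :=
  [set Y : {set point n} | (Y \subset calQ n) &&
    [forall p in Y, forall q in Y,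
      ((pmax p q).1 + (pmax p q).2 <= n.+1) ==>
      (pmin p q \in Y) && ((pmax p q \in calQ n) ==> (pmax p q \in Y))]].

Definition calP (n : nat) : {set {set point n}} :=
  [set X in calR n | (ord0, ord0) \in X].

(* The element k of {1 < ... < n+1} is the ordinal of value k - 1; the        *)
(* endpoints a and b are 1-based.                                             *)
Definition interval (n a b : nat) : {set 'I_n.+1} :=
  [set i : 'I_n.+1 | a <= i.+1 <= b].

(* Neither subtraction truncates, since 1 <= a and b <= n+1.                  *)
Definition open_interval_points (n : nat) (tau : {set {set 'I_n.+1}}) :
    {set point n} :=
  [set p in calQ n | [exists a : 'I_n.+2, exists b : 'I_n.+2,
    [&& 1 <= a, a <= b, b <= n.+1, interval n a b \in tau,
        p.1 == n.+1 - b :> nat & p.2 == a - 1 :> nat]]].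

(* Main.v *)
(* A point p of Q(n) encodes an interval, its box; pmax encodes intersections *)
(* of boxes and pmin unions of overlapping or abutting boxes, so the open     *)
(* intervals of a convex topology form an element of P(n), and they generate  *)
(* the topology. Conversely, for X in P(n) the unions of boxes of X form a    *)
(* convex topology; an interval covered by boxes of X is itself such a box,   *)
(* because boxes can be merged one after the other from its left end.         *)

Require Import Defs.
From mathcomp Require Import all_boot all_order.
From mathcomp Require Import zify.
Import Order.TTheory.

Set Implicit Arguments.
Unset Strict Implicit.
Unset Printing Implicit Defensive.

(** The maps [open_interval_points] and [box_topology] are mutually inverse. In a convex topology
    every open set is a union of open convex sets; non-empty ones are boxes, so the open boxes
    recover the topology ([open_interval_pointsK]). Conversely, [calP] makes the boxes of X generate
    a convex topology ([box_topology_convex]), and [box_topology_mem] shows that no further interval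
    becomes open. The bound n+1 in [calR] admits abutting boxes, whose union is again an interval.
    Any other chain of n+1 points is handled by transport along its order isomorphism with
    ['I_n.+1]. *)

Section ConvexTopology.
Variables (disp : Order.disp_t) (T : finOrderType disp).
Implicit Types (tau : {set {set T}}) (A U : {set T}).

Lemma order_convexP A :
  reflect (forall x y z, x \in A -> y \in A -> (x <= z <= y)%O -> z \in A)
          (order_convex A).
Proof.
apply: (iffP idP) => [+ x y z xA yA xzy | cA].
  by move=> /forall_inP/(_ x xA)/forall_inP/(_ y yA)/forallP/(_ z)/implyP; apply.
apply/forall_inP => x xA; apply/forall_inP => y yA; apply/forallP => z.
by apply/implyP; apply: cA.
Qed.

(** Finiteness reduces arbitrary unions to binary ones, and a convex base to the existence of open
    convex neighbourhoods inside each open set. *)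
Lemma convex_topologyP tau :
  reflect [/\ set0 \in tau, setT \in tau,
              {in tau &, forall U V, U :|: V \in tau},
              {in tau &, forall U V, U :&: V \in tau}
            & {in tau, forall U x, x \in U ->
                 exists A, [/\ A \in tau, order_convex A, x \in A & A \subset U]}]
          (tau \in convex_topologies T).
Proof.
rewrite inE.
apply: (iffP andP) => [[/and4P[tau0 tauT tauU tauI]] |
                       [tau0 tauT tauU tauI locc]].
  case/existsP => B /andP[/andP[/subsetP Btau /forall_inP Bbase] /forall_inP Bc].
  split => // [U V Utau Vtau | U V Utau Vtau | U Utau x xU].
  - have /forallP/(_ [set U; V]) := tauU.
    rewrite subUset !sub1set Utau Vtau /cover /=.
    by case: (eqVneq U V) => [-> _ | ?]; rewrite ?setUid // bigcup_setU !big_set1.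
  - by have /forall_inP/(_ U Utau)/forall_inP/(_ V Vtau) := tauI.
  - have /existsP[F /andP[/subsetP FB /eqP defU]] := Bbase U Utau.
    move: xU; rewrite defU => /bigcupP[A AF xA]; exists A; split=> //.
    + exact/Btau/FB.
    + exact/Bc/FB.
    + exact: bigcup_sup.
have tau_cover (F : {set {set T}}) : F \subset tau -> cover F \in tau.
  by move=> /subsetP Ftau; apply: (big_ind (fun U => U \in tau)).
split.
  apply/and4P; split=> //; first by apply/forallP => F; apply/implyP/tau_cover.
  by apply/forall_inP => U Utau; apply/forall_inP => V; apply: tauI.
(* The largest candidate for a convex base: all open convex sets. *)
apply/existsP; exists [set A in tau | order_convex A].
rewrite andbC; apply/andP; split.
  by apply/forall_inP => A; rewrite inE => /andP[].
apply/andP; split; first by apply/subsetP => A; rewrite inE => /andP[].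
apply/forall_inP => U Utau; apply/existsP.
exists [set A in tau | order_convex A & A \subset U]; apply/andP; split.
  by apply/subsetP => A; rewrite !inE => /and3P[-> ->].
rewrite eqEsubset; apply/andP; split; last first.
  by apply/bigcupsP => A; rewrite inE => /and3P[].
apply/subsetP => x xU; have [A [Atau cA xA AU]] := locc U Utau x xU.
by apply/bigcupP; exists A; rewrite ?inE ?Atau ?cA.
Qed.

End ConvexTopology.

(** * Transport along order isomorphisms *)

Section OrderIsomorphism.
Variables (d d' : Order.disp_t) (T : finOrderType d) (T' : finOrderType d').
Variables (f : T -> T') (g : T' -> T).
Hypotheses (fK : cancel f g) (gK : cancel g f).
Hypothesis f_mono : {mono f : x y / (x <= y)%O}.

Lemma imset_convex_topologies (tau : {set {set T}}) :
  tau \in convex_topologies T ->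
  [set f @: U | U : {set T} in tau] \in convex_topologies T'.
Proof.
have injf := can_inj fK.
case/convex_topologyP => tau0 tauT tauU tauI locc; apply/convex_topologyP; split.
- by apply/imsetP; exists set0; rewrite ?imset0.
- apply/imsetP; exists setT => //; apply/setP => y.
  by rewrite inE -[y]gK imset_f ?inE.
- move=> _ _ /imsetP[U Utau ->] /imsetP[V Vtau ->].
  by rewrite -imsetU imset_f ?tauU.
- move=> _ _ /imsetP[U Utau ->] /imsetP[V Vtau ->].
  by rewrite -imsetI ?imset_f ?tauI // => x y _ _; apply: injf.
- move=> _ /imsetP[U Utau ->] _ /imsetP[x xU ->].
  have [A [Atau /order_convexP cA xA AU]] := locc U Utau x xU.
  exists (f @: A); split; rewrite ?imset_f ?imsetS //.
  apply/order_convexP => _ _ z /imsetP[a aA ->] /imsetP[b bA ->].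
  by rewrite -[z]gK !f_mono mem_imset // => /(cA _ _ _ aA bA).
Qed.

(** Direct image under [f] is injective on families of sets. Applying this to [f] and then to its
    inverse gives equality of the cardinals. *)
Lemma leq_card_convex_topologies :
  #|convex_topologies T| <= #|convex_topologies T'|.
Proof.
rewrite -(card_imset _ (imset_inj (imset_inj (can_inj fK)))).
apply/subset_leq_card/subsetP => _ /imsetP[tau /imset_convex_topologies tauc ->].
exact: tauc.
Qed.

End OrderIsomorphism.

(** * Intervals as boxes, and the topologies they generate *)

Section Boxes.
Variable n : nat.
Implicit Types (p q : point n) (X : {set point n}) (U : {set 'I_n.+1}).

(* If p = (n + 1 - b, a - 1) this is {a, ..., b}; elements of the ordinal are  *)
(* 0-based, and i + p.1 <= n replaces i <= n - p.1.                            *)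
Definition box p : {set 'I_n.+1} :=
  [set i : 'I_n.+1 | (p.2 <= i) && (i + p.1 <= n)].

Lemma pmin1E p q : (pmin p q).1 = minn p.1 q.1 :> nat.
Proof. by rewrite /pmin /Order.min /minn ltEord /=; case: ifP. Qed.

Lemma pmin2E p q : (pmin p q).2 = minn p.2 q.2 :> nat.
Proof. by rewrite /pmin /Order.min /minn ltEord /=; case: ifP. Qed.

Lemma pmax1E p q : (pmax p q).1 = maxn p.1 q.1 :> nat.
Proof. by rewrite /pmax /Order.max /maxn ltEord /=; case: ifP. Qed.

Lemma pmax2E p q : (pmax p q).2 = maxn p.2 q.2 :> nat.
Proof. by rewrite /pmax /Order.max /maxn ltEord /=; case: ifP. Qed.

Lemma box_pmax p q : box (pmax p q) = box p :&: box q.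
Proof. by apply/setP => i; rewrite !inE pmax1E pmax2E; lia. Qed.

(** Both boxes are non-empty, and the bound says that no point lies strictly between them; equality
    with n+1 is the abutting case. *)
Lemma box_pmin p q : p \in calQ n -> q \in calQ n ->
  (pmax p q).1 + (pmax p q).2 <= n.+1 -> box (pmin p q) = box p :|: box q.
Proof.
rewrite !inE pmax1E pmax2E => pQ qQ pq.
by apply/setP => i; rewrite !inE pmin1E pmin2E; lia.
Qed.

Lemma box00 : box (ord0, ord0) = setT.
Proof. by apply/setP => i; have := ltn_ord i; rewrite !inE /=; lia. Qed.

Lemma mem_box_calQ p i : i \in box p -> p \in calQ n.
Proof. by rewrite !inE; lia. Qed.

(** A non-empty box contains its own endpoints, of values [p.2] and [n - p.1]. *)
Lemma box_subset p q : p \in calQ n -> box p \subset box q -> q.1 <= p.1 /\ q.2 <= p.2.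
Proof.
rewrite inE /= => pQ /subsetP sub.
have lo : p.2 < n.+1 by [].
have hi : n - p.1 < n.+1 by lia.
have : Ordinal hi \in box q by apply: sub; rewrite inE /=; lia.
have : Ordinal lo \in box q by apply: sub; rewrite inE /=; lia.
by rewrite !inE /=; lia.
Qed.

Lemma order_convex_box p : order_convex (box p).
Proof. by apply/order_convexP => x y z; rewrite !inE !leEord; lia. Qed.

Lemma order_convex_eq_box U x :
  order_convex U -> x \in U -> exists2 p, p \in calQ n & U = box p.
Proof.
move=> /order_convexP cU xU.
case: (arg_minnP (fun i : 'I_n.+1 => i : nat) xU) => lo loU lo_min.
case: (arg_maxnP (fun i : 'I_n.+1 => i : nat) xU) => hi hiU hi_max.
have lohi := lo_min _ hiU; have hin := ltn_ord hi.
(* [rev_ord hi] has value n - hi, the distance of the maximum from the right end of the chain. *)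
exists (rev_ord hi, lo); first by rewrite inE /=; lia.
apply/setP => i; rewrite inE /=; apply/idP/idP => [iU | lihi].
  by have := lo_min _ iU; have := hi_max _ iU; lia.
by apply: (cU lo hi) => //; rewrite !leEord; lia.
Qed.

Lemma calRP X : reflect (X \subset calQ n /\ {in X &, forall p q,
    (pmax p q).1 + (pmax p q).2 <= n.+1 ->
    pmin p q \in X /\ (pmax p q \in calQ n -> pmax p q \in X)})
  (X \in calR n).
Proof.
rewrite inE; apply: (iffP andP) => -[XQ XR]; split=> //.
  move=> p q pX qX pq; have /forall_inP/(_ p pX)/forall_inP/(_ q qX) := XR.
  by rewrite pq => /andP[? /implyP].
apply/forall_inP => p pX; apply/forall_inP => q qX; apply/implyP => pq.
by have [-> /implyP] := XR p q pX qX pq.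
Qed.

Lemma mem_open_interval_points tau p :
  (p \in open_interval_points tau) = (p \in calQ n) && (box p \in tau).
Proof.
rewrite in_set; apply: andb_id2l; rewrite inE /= => pQ.
have box_interval a b : a <= b <= n.+1 -> 0 < a -> p.1 = n.+1 - b :> nat ->
    p.2 = a - 1 :> nat -> interval n a b = box p.
  by move=> ab a0 p1 p2; apply/setP => i; rewrite !inE; lia.
apply/existsP/idP => [[a /existsP[b]] | ptau].
  move=> /and5P[a1 ab bn abtau /andP[/eqP p1 /eqP p2]].
  by rewrite -(@box_interval a b) ?ab.
(* Solving the encoding for the 1-based endpoints gives a = [p.2] + 1 and b = n + 1 - [p.1]. *)
have an : p.2.+1 < n.+2 by rewrite ltnS.
have bn : n.+1 - p.1 < n.+2 by rewrite ltnS leq_subr.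
exists (Ordinal an); apply/existsP; exists (Ordinal bn).
rewrite (@box_interval p.2.+1 (n.+1 - p.1)) //=; [|lia..].
by rewrite ptau /=; lia.
Qed.

Definition box_topology X : {set {set 'I_n.+1}} :=
  [set U : {set 'I_n.+1} | [forall x in U, [exists p in X, (x \in box p) && (box p \subset U)]]].

Lemma box_topologyP X U :
  reflect (forall x, x \in U -> exists p, [/\ p \in X, x \in box p & box p \subset U])
          (U \in box_topology X).
Proof.
rewrite inE; apply: (iffP forall_inP) => XU x xU.
  by have /exists_inP[p pX /andP[]] := XU x xU; exists p.
by have [p [pX xp pU]] := XU x xU; apply/exists_inP; exists p; rewrite ?xp.
Qed.

Lemma open_interval_points_calP tau :
  tau \in convex_topologies 'I_n.+1 -> open_interval_points tau \in calP n.
Proof.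
case/convex_topologyP => tau0 tauT tauU tauI _; rewrite inE; apply/andP; split; last first.
  by rewrite mem_open_interval_points box00 tauT inE.
apply/calRP; split; first by apply/subsetP => p; rewrite mem_open_interval_points => /andP[].
move=> p q; rewrite !mem_open_interval_points => /andP[pQ ptau] /andP[qQ qtau] pq.
rewrite box_pmin // box_pmax tauU // tauI //= !andbT; split=> //.
by move: pQ qQ; rewrite !inE pmin1E pmin2E; lia.
Qed.

Lemma box_mem_box_topology X p : p \in X -> box p \in box_topology X.
Proof. by move=> pX; apply/box_topologyP => x xp; exists p. Qed.

Lemma box_topology_convex X : X \in calP n -> box_topology X \in convex_topologies 'I_n.+1.
Proof.
rewrite inE => /andP[/calRP[XQ XR] X00]; apply/convex_topologyP; split.
- by apply/box_topologyP => x; rewrite inE.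
- by rewrite -box00 box_mem_box_topology.
- move=> U V /box_topologyP XU /box_topologyP XV; apply/box_topologyP => x.
  case/setUP => [/XU | /XV] [p [pX xp sub]]; exists p; split=> //.
    exact: subset_trans (subsetUl _ _).
  exact: subset_trans (subsetUr _ _).
- move=> U V /box_topologyP XU /box_topologyP XV; apply/box_topologyP => x.
  (* The common point [x] makes the intersection of the two boxes non-empty, so [pmax p q] lies in
     [calQ n] and the closure property of X applies. *)
  case/setIP => /XU[p [pX xp pU]] /XV[q [qX xq qV]]; exists (pmax p q).
  have xpq : x \in box (pmax p q) by rewrite box_pmax inE xp.
  have pqQ := mem_box_calQ xpq; split=> //; last by rewrite box_pmax setISS.
  have [|_] := XR p q pX qX; last exact.
  by move: pqQ; rewrite inE => /leqW.
- move=> U /box_topologyP XU x /XU[p [pX xp pU]].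
  by exists (box p); rewrite order_convex_box box_mem_box_topology.
Qed.

(* Among the members of X whose boxes lie in box p and start where box p does, *)
(* the longest must be p: otherwise a box of X through the next point overlaps *)
(* or abuts it, and their union would be longer.                               *)
Lemma box_topology_mem X p :
  X \in calP n -> p \in calQ n -> box p \in box_topology X -> p \in X.
Proof.
rewrite inE => /andP[/calRP[/subsetP XQ XR] _] pQ /box_topologyP Xp.
have /= pn : p.1 + p.2 <= n by move: pQ; rewrite inE.
pose good q := (q \in X) && (box q \subset box p) && (q.2 == p.2).
have [q0 good0] : exists q, good q.
  (* A box of X around the left endpoint of [box p] and inside [box p] must start there. *)
  have [|q [qX]] := Xp p.2; first by rewrite inE leqnn /=; lia.
  rewrite inE /= => /andP[q2 _] qp; exists q; rewrite /good qX qp -val_eqE /=.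
  by have /= [_] := box_subset (XQ _ qX) qp; lia.
(* With the left endpoint fixed, the smallest first coordinate gives the longest box. *)
case: (arg_minnP (fun q : point n => q.1 : nat) good0) => q.
rewrite -/(good q) => /andP[/andP[qX qp] /eqP q2] q_min.
have /= [le1 _] := box_subset (XQ _ qX) qp.
have [eq1 | ne1] := eqVneq q.1 p.1.
  by rewrite [p]surjective_pairing -eq1 -q2 -surjective_pairing.
have /= lt1 : p.1 < q.1 by rewrite ltn_neqAle le1 eq_sym val_eqE ne1.
have /= q1n := ltn_ord q.1.
have /= qn : q.1 + q.2 <= n by have := XQ _ qX; rewrite inE.
(* The right endpoint of [box q] is n - [q.1], so this is the next point; it is still in [box p]
   because [p.1 < q.1]. *)
have /= xn : n.+1 - q.1 < n.+1 by move=> /=; lia.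
have [|r [rX]] := Xp (Ordinal xn); first by rewrite inE /= -q2 /=; lia.
rewrite inE /= => /andP[r2 r1] rp.
have /= [ler1 ler2] := box_subset (XQ _ rX) rp.
have qr : (pmax q r).1 + (pmax q r).2 <= n.+1.
  by rewrite pmax1E pmax2E q2 /=; lia.
have [qrX _] := XR _ _ qX rX qr.
have : good (pmin q r).
  rewrite /good qrX box_pmin ?XQ // subUset qp rp -val_eqE /= pmin2E q2.
  by apply/eqP => /=; lia.
by move/q_min; rewrite pmin1E /=; lia.
Qed.

Lemma box_topologyK X : X \in calP n -> open_interval_points (box_topology X) = X.
Proof.
move=> XP; apply/setP => p; rewrite mem_open_interval_points.
apply/andP/idP => [[] | pX]; first exact: box_topology_mem.
split; last exact: box_mem_box_topology.
by move: XP; rewrite inE => /andP[/calRP[/subsetP XQ _] _]; apply: XQ.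
Qed.

(** A convex open neighbourhood is an open box by [order_convex_eq_box]; conversely, a union of open
    boxes is open. *)
Lemma open_interval_pointsK tau :
  tau \in convex_topologies 'I_n.+1 -> box_topology (open_interval_points tau) = tau.
Proof.
case/convex_topologyP => tau0 _ tauU _ locc; apply/setP => U.
apply/box_topologyP/idP => [XU | Utau x xU].
  have -> : U = \bigcup_(p in open_interval_points tau | box p \subset U) box p.
    apply/eqP; rewrite eqEsubset; apply/andP; split.
      apply/subsetP => x /XU[p [pX xp pU]].
      by apply/bigcupP; exists p; rewrite ?pX.
    by apply/bigcupsP => p /andP[].
  apply: (big_ind (fun V => V \in tau)) => // p /andP[].
  by rewrite mem_open_interval_points => /andP[].
have [A [Atau cA xA AU]] := locc U Utau x xU.
have [p pQ defA] := order_convex_eq_box cA xA.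
by exists p; rewrite mem_open_interval_points pQ -defA.
Qed.

End Boxes.

Theorem mainTheorem7 (n : nat) :
  [/\ {in convex_topologies 'I_n.+1 &, injective (@open_interval_points n)},
      [set open_interval_points tau | tau in convex_topologies 'I_n.+1] = calP n
    & forall (disp : Order.disp_t) (T : finOrderType disp),
        #|T| = n.+1 -> #|convex_topologies T| = #|calP n| ].
Proof.
have inj : {in convex_topologies 'I_n.+1 &, injective (@open_interval_points n)}.
  exact: can_in_inj (@open_interval_pointsK n).
have im : [set open_interval_points tau | tau in convex_topologies 'I_n.+1] = calP n.
  apply/setP => X; apply/imsetP/idP => [[tau tauc ->] | XP].
    exact: open_interval_points_calP.
  by exists (box_topology X); rewrite ?box_topology_convex ?box_topologyK.
split=> // disp T cardT; rewrite -im card_in_imset //.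
(* The order isomorphism sends each element to its rank in the increasing enumeration of [T]. *)
pose f (x : T) : 'I_n.+1 := cast_ord cardT (Order.enum_rank x).
pose g (i : 'I_n.+1) : T := Order.enum_val (cast_ord (esym cardT) i).
have fK : cancel f g by move=> x; rewrite /f /g cast_ordK Order.enum_rankK.
have gK : cancel g f by move=> i; rewrite /f /g Order.enum_valK cast_ordKV.
have f_mono : {mono f : x y / (x <= y)%O}.
  by move=> x y; rewrite -(Order.le_enum_rank (@Order.le_total _ T)).
have g_mono : {mono g : x y / (x <= y)%O} := can_mono gK f_mono.
apply/eqP; rewrite eqn_leq (leq_card_convex_topologies fK gK f_mono).
exact: leq_card_convex_topologies gK fK g_mono.
Qed.
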